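(* Let $\sigma^2>0$ and let $a,b,c$ be fixed real numbers. Put $$D=(1-a-b-c)(1-a+b+c)(1+a-b+c)(1+a+b-c).$$ There exist (on some probability space) a collection $\epsilon=\{\epsilon_{i,j},\ i,j\in\mathbb{Z}\}$ of uncorrelated random variables with zero mean and equal variance $\sigma^2$ and a wide-sense stationary random field $X=\{X_{i,j},\ i,j\in\mathbb{Z}\}$ satisfying $$X_{i,j}=aX_{i-1,j}+bX_{i,j-1}+cX_{i-1,j-1}+\epsilon_{i,j}\qquad\text{for all } i,j\in\mathbb{Z}$$ if and only if $D>0$.
   Context: All random variables are real-valued. A random field $X=\{X_{i,j},\ i,j\in\mathbb{Z}\}$ is wide-sense stationary if all $X_{i,j}$ have finite second moment, $\mathsf{E}X_{i,j}$ does not depend on $(i,j)$, and $\operatorname{cov}(X_{i,j},X_{i-h_1,j-h_2})$ depends only on $(h_1,h_2)$. *)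

(* Defs.v *)
From HB Require Import structures.
From mathcomp Require Import all_boot all_order all_algebra.
From mathcomp Require Import all_classical all_reals all_analysis.

Set Implicit Arguments.
Unset Strict Implicit.
Unset Printing Implicit Defensive.

Import Order.TTheory GRing.Theory Num.Theory.

Local Open Scope ring_scope.

(* Square integrability is required first because covariance and expectation
   are total functions that return default values on non-integrable input. *)
Definition wide_sense_stationary (R : realType) (d : measure_display)
    (T : measurableType d) (P : probability T R)
    (X : int -> int -> {RV P >-> R}) : Prop :=
  [/\ (forall i j, (X i j : T -> R) \in Lfun P 2%:E),
      (forall i j i' j', ('E_P[X i j] = 'E_P[X i' j'])%E) &
      (forall h1 h2 i j i' j',
         covariance P (X i j) (X (i - h1) (j - h2)) =
         covariance P (X i' j') (X (i' - h1) (j' - h2)))].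

Definition uncorrelated_noise (R : realType) (d : measure_display)
    (T : measurableType d) (P : probability T R) (s2 : R)
    (eps : int -> int -> {RV P >-> R}) : Prop :=
  [/\ (forall i j, (eps i j : T -> R) \in Lfun P 2%:E),
      (forall i j, ('E_P[eps i j] = 0)%E),
      (forall i j, ('V_P[eps i j] = s2%:E)%E) &
      (forall i j k l, (i, j) <> (k, l) ->
         (covariance P (eps i j) (eps k l) = 0)%E)].

(* Equality of random variables is almost sure equality. *)
Definition satisfies_recursion (R : realType) (d : measure_display)
    (T : measurableType d) (P : probability T R) (a b c : R)
    (eps X : int -> int -> {RV P >-> R}) : Prop :=
  forall i j : int, {ae P, forall w : T,
    X i j w = a * X (i - 1) j w + b * X i (j - 1) w
              + c * X (i - 1) (j - 1) w + eps i j w}.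

(* Main.v *)
(* Write Phi(x, y) = 1 - a x - b y - c x y, so that the recursion reads
   Phi(shifts) X = eps. Both directions go through the question whether Phi has
   a square-summable inverse psi on the lattice Z^2, Phi(shifts) psi = delta.
   If (X, eps) exists then k |-> cov(X_k, eps_0) / sigma^2 is such a psi, by
   stationarity and Bessel's inequality; conversely a psi convolved with white
   noise gives X.

   If D <= 0, then Phi has a zero on the torus |x| = |y| = 1: with |x| = 1, the
   equation |1 - a x| = |b + c x| reads 1 + a^2 - b^2 - c^2 = 2 (a + b c) Re x, and
   D = (1 + a^2 - b^2 - c^2)^2 - (2 (a + b c))^2. A plane wave at this zero,
   multiplied by Phi(shifts) psi = delta and summed by parts over the square of
   side about 2 m, bounds the l1 norm of psi on the boundary of the square from
   below, hence its l2 norm squared by a multiple of 1 / m: the harmonic series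
   contradicts square summability.

   If D > 0, an even number of its four factors is negative and a reflection of
   one or both axes reduces to the case where all of them are positive. Then the
   causal solution of the recursion is square summable by an energy estimate. *)
Require Import Defs.
From HB Require Import structures.
From mathcomp Require Import all_boot all_order all_algebra.
From mathcomp Require Import ring lra complex.
From mathcomp Require Import all_classical all_reals all_analysis measurable_realfun.
Import Order.TTheory GRing.Theory Num.Theory.
Local Open Scope ring_scope.

Set Implicit Arguments.
Unset Strict Implicit.
Unset Printing Implicit Defensive.

(** * Square-summable inverses when D > 0 *)

(* The sum over [- n, n - 1], since [Negz i] is [- i - 1]. *)
Definition intsum {R : realType} (f : int -> R) (n : nat) : R :=
  \sum_(i < n) (f (Posz i) + f (Negz i)).

Definition square_summable {R : realType} (psi : int -> int -> R) : Prop :=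
  exists K, forall n, intsum (fun i => intsum (fun j => psi i j ^+ 2) n) n <= K.

Definition fundamental_solution {R : realType} (p0 p1 p2 p3 : R)
    (psi : int -> int -> R) : Prop :=
  forall i j, p0 * psi i j + p1 * psi (i - 1) j + p2 * psi i (j - 1)
              + p3 * psi (i - 1) (j - 1) = ((i == 0) && (j == 0))%:R.

(* With B := 1 - a^2 - b^2 + c^2, the quadratic form in (s, u) has determinant
   kappa B - 1 - kappa^2 (a b + c)^2; this is positive at kappa = 2 / B because
   B - 2 (a b + c) and B + 2 (a b + c) are products of two of the factors of D. *)
Lemma storage_exists {R : realType} (a b c : R) :
  0 < 1 - a - b - c -> 0 < 1 - a + b + c ->
  0 < 1 + a - b + c -> 0 < 1 + a + b - c ->
  exists kappa eta : R, [/\ 0 < kappa, 0 < eta & forall s u : R,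
    eta * u ^+ 2 <= kappa * s ^+ 2 + u ^+ 2 - (b * u + s) ^+ 2
                    - kappa * (a * s + (a * b + c) * u) ^+ 2].
Proof.
move=> f1 f2 f3 f4.
set e := a * b + c.
pose B := 1 - a ^+ 2 - b ^+ 2 + c ^+ 2.
have Bm : 0 < B - 2 * e.
  have -> : B - 2 * e = (1 - a - b - c) * (1 + a + b - c) by rewrite /B /e; ring.
  exact: mulr_gt0.
have Bp : 0 < B + 2 * e.
  have -> : B + 2 * e = (1 - a + b + c) * (1 + a - b + c) by rewrite /B /e; ring.
  exact: mulr_gt0.
have B0 : 0 < B by lra.
have a1 : B < 2 * (1 - a ^+ 2).
  have h1 := mulr_gt0 f1 f3; have h2 := mulr_gt0 f2 f4.
  rewrite /B; nra.
have Be : 4 * e ^+ 2 < B ^+ 2 by have := mulr_gt0 Bm Bp; nra.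
pose k := 2 / B.
have kB : k * B = 2 by rewrite /k divfK// gt_eqF.
have k0 : 0 < k by rewrite /k divr_gt0.
pose A := k * (1 - a ^+ 2) - 1.
pose Q := b + k * a * e.
pose C := 1 - b ^+ 2 - k * e ^+ 2.
have A0 : 0 < A.
  rewrite /A; have : k * B < k * (2 * (1 - a ^+ 2)) by rewrite ltr_pM2l.
  lra.
have det : A * C - Q ^+ 2 = k * B - 1 - k ^+ 2 * e ^+ 2.
  by rewrite /A /C /Q /B /e; ring.
have det0 : 0 < A * C - Q ^+ 2.
  rewrite det kB.
  have h : k ^+ 2 * (4 * e ^+ 2) < k ^+ 2 * B ^+ 2 by rewrite ltr_pM2l// exprn_gt0.
  have h2 : k ^+ 2 * B ^+ 2 = 4 by rewrite -exprMn kB; ring.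
  lra.
exists k, ((A * C - Q ^+ 2) / A); split=> //; first exact: divr_gt0.
move=> s u; rewrite -subr_ge0.
have -> : k * s ^+ 2 + u ^+ 2 - (b * u + s) ^+ 2 - k * (a * s + e * u) ^+ 2
    - (A * C - Q ^+ 2) / A * u ^+ 2 = (A * s - Q * u) ^+ 2 / A.
  have An : A != 0 by rewrite gt_eqF.
  apply: (mulIf An); rewrite mulrBl (mulrAC _ _ A) !divfK//.
  by rewrite /A /C /Q; ring.
by rewrite divr_ge0// ?sqr_ge0// ltW.
Qed.

Section causal.
Context {R : realType} (a b c : R).

(* State-space (Roesser) form of the recursion: [vstate] is carried from row to
   row and [hstate] along each row; the only input is [hstate = 1] at the start
   of row 0, and the solution is the vertical output of each row. *)
Fixpoint hstate (s0 : R) (u : nat -> R) (i : nat) : R :=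
  if i is i'.+1 then a * hstate s0 u i' + (a * b + c) * u i' else s0.

Fixpoint vstate (j : nat) (i : nat) : R :=
  if j is j'.+1 then b * vstate j' i + hstate (j' == 0)%:R (vstate j') i else 0.

Definition causal_solution (i j : int) : R :=
  match i, j with Posz m, Posz n => vstate n.+1 m | _, _ => 0 end.

(** With u = [vstate j], h the [hstate] of row j and X = b u + h its output, the state passed to the
    next column is a X + c u = a h + (a b + c) u, where u is the output of row j - 1. *)
Lemma causal_solutionP : fundamental_solution 1 (- a) (- b) (- c) causal_solution.
Proof.
have Pz (n : nat) : Posz n.+1 - 1 = Posz n by rewrite -addn1 PoszD addrK.
have Nz (n : nat) : Negz n - 1 = Negz n.+1 by rewrite !NegzE; ring.
have Z : 0%:Z - 1 = Negz 0 by [].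
move=> [[|i]|i] [[|j]|j]; rewrite ?Pz ?Nz ?Z /=; ring.
Qed.

(** The hypothesis says that each lattice point dissipates at least eta u^2 of the energy kappa h^2
    + u^2 entering it. Over a rectangle the energy differences telescope, so the total dissipation
    is at most the energy entering from outside, and that is kappa, carried by the single unit
    input. *)
Lemma vstate_energy (kappa eta : R) (n m : nat) :
  0 < kappa -> 0 < eta ->
  (forall s u : R, eta * u ^+ 2 <= kappa * s ^+ 2 + u ^+ 2 - (b * u + s) ^+ 2
                    - kappa * (a * s + (a * b + c) * u) ^+ 2) ->
  eta * \sum_(i < n) \sum_(j < m) vstate j i ^+ 2 <= kappa.
Proof.
move=> k0 e0 dissip.
pose h (j : nat) := hstate (j == 0)%:R (vstate j).
apply: (@le_trans _ _ (\sum_(i < n) \sum_(j < m)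
   ((kappa * h j i ^+ 2 - kappa * h j i.+1 ^+ 2) + (vstate j i ^+ 2 - vstate j.+1 i ^+ 2)))).
  rewrite mulr_sumr; apply: ler_sum => i _; rewrite mulr_sumr; apply: ler_sum => j _.
  apply: le_trans (dissip (h j i) (vstate j i)) _.
  by rewrite /h /=; lra.
have tel (f : nat -> R) p : \sum_(i < p) (f i - f i.+1) = f 0 - f p.
  by elim: p => [|p IH]; rewrite ?big_ord0 ?big_ord_recr /= ?IH; lra.
rewrite (eq_bigr (fun i : 'I_n => \sum_(j < m) (kappa * h j i ^+ 2 - kappa * h j i.+1 ^+ 2)
    + (vstate 0 i ^+ 2 - vstate m i ^+ 2))); last first.
  by move=> i _; rewrite big_split /= (tel (fun j => vstate j i ^+ 2)).
rewrite big_split /= exchange_big /=.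
rewrite (eq_bigr (fun j : 'I_m => kappa * h j 0 ^+ 2 - kappa * h j n ^+ 2)); last first.
  by move=> j _; rewrite (tel (fun i => kappa * h j i ^+ 2)).
rewrite -[leRHS]addr0; apply: lerD; last first.
  by apply: sumr_le0 => i _; rewrite expr0n sub0r oppr_le0 sqr_ge0.
case: m => [|m]; first by rewrite big_ord0 ltW.
rewrite big_ord_recl /= -[leRHS]addr0; apply: lerD.
  by rewrite /h /= expr1n mulr1 gerBl mulr_ge0 ?sqr_ge0// ltW.
apply: sumr_le0 => j _; rewrite /h /= expr0n mulr0 sub0r oppr_le0.
by rewrite mulr_ge0 ?sqr_ge0// ltW.
Qed.

Lemma causal_solution_square_summable :
  0 < 1 - a - b - c -> 0 < 1 - a + b + c ->
  0 < 1 + a - b + c -> 0 < 1 + a + b - c -> square_summable causal_solution.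
Proof.
move=> f1 f2 f3 f4; have [k [e [k0 e0 dissip]]] := storage_exists f1 f2 f3 f4.
exists (k / e) => n; rewrite ler_pdivlMr// mulrC.
(* Row j of the solution is [vstate j.+1], hence [n.+1] rows of states; the extra row [vstate 0]
   vanishes. *)
apply: le_trans (@vstate_energy k e n n.+1 k0 e0 dissip).
rewrite ler_pM2l//; apply: ler_sum => i _; rewrite /intsum /=.
rewrite [X in _ + X]big1 ?addr0; last by move=> j _; rewrite expr0n addr0.
rewrite [leRHS]big_ord_recl (expr0n _ 2) add0r; apply: ler_sum => j _.
by rewrite addr0.
Qed.

End causal.

(** Keeping a coefficient p0 instead of 1 makes the family of operators stable under reflections of
    the lattice, which permute the four coefficients. *)
Definition has_l2_solution {R : realType} (p0 p1 p2 p3 : R) : Prop :=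
  exists psi, fundamental_solution p0 p1 p2 p3 psi /\ square_summable psi.

Lemma has_l2_solution_scale {R : realType} (t p0 p1 p2 p3 : R) : t != 0 ->
  has_l2_solution p0 p1 p2 p3 ->
  has_l2_solution (t * p0) (t * p1) (t * p2) (t * p3).
Proof.
move=> t0 [psi [fs [K sK]]]; exists (fun i j => psi i j / t); split.
  by move=> i j; rewrite -fs; field.
exists (K * t^-1 ^+ 2) => n.
apply: le_trans (ler_wpM2r (sqr_ge0 _) (sK n)).
rewrite /intsum mulr_suml le_eqVlt; apply/orP; left; apply/eqP; apply: eq_bigr => i _.
by rewrite mulrDl !mulr_suml; congr (_ + _); apply: eq_bigr => j _;
  rewrite mulrDl !exprMn.
Qed.

Lemma has_l2_solution_swap {R : realType} (p0 p1 p2 p3 : R) :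
  has_l2_solution p0 p2 p1 p3 -> has_l2_solution p0 p1 p2 p3.
Proof.
move=> [psi [fs [K sK]]]; exists (fun i j => psi j i); split.
  by move=> i j; rewrite andbC -fs; ring.
exists K => n; apply: le_trans (sK n); rewrite /intsum.
under eq_bigr do rewrite -big_split.
rewrite exchange_big /= le_eqVlt; apply/orP; left; apply/eqP.
apply: eq_bigr => i _; rewrite -big_split; apply: eq_bigr => j _ /=; ring.
Qed.

(** The reflection i |-> - i - 1 exchanges [Posz n] and [Negz n], so it preserves every range of
    [intsum]; it turns the pair (i, i - 1) into (- i - 1, - i), which exchanges the roles of p0 and
    p1, and of p2 and p3. *)
Lemma has_l2_solution_flip {R : realType} (p0 p1 p2 p3 : R) :
  has_l2_solution p1 p0 p3 p2 -> has_l2_solution p0 p1 p2 p3.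
Proof.
move=> [psi [fs [K sK]]]; exists (fun i j => psi (- i - 1) j); split.
  move=> i j; have -> : - (i - 1) - 1 = - i by ring.
  by rewrite -(oppr_eq0 i) -fs; ring.
have P2N (n : nat) : - Posz n - 1 = Negz n by rewrite NegzE; ring.
have N2P (n : nat) : - Negz n - 1 = Posz n by rewrite NegzE; ring.
exists K => n; apply: le_trans (sK n); rewrite /intsum.
rewrite le_eqVlt; apply/orP; left; apply/eqP.
by apply: eq_bigr => i _; rewrite P2N N2P addrC.
Qed.

Lemma has_l2_solution_causal {R : realType} (p0 p1 p2 p3 : R) :
  0 < p0 + p1 + p2 + p3 -> 0 < p0 + p1 - p2 - p3 ->
  0 < p0 - p1 + p2 - p3 -> 0 < p0 - p1 - p2 + p3 ->
  has_l2_solution p0 p1 p2 p3.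
Proof.
move=> f1 f2 f3 f4.
(* The four hypotheses add up to 4 p0. *)
have p00 : 0 < p0 by lra.
have pn : p0 != 0 by rewrite gt_eqF.
have e (x : R) : x = p0 * - (- x / p0) by field.
rewrite -[p0]mulr1 (e p1) (e p2) (e p3); apply: has_l2_solution_scale => //.
set a := - p1 / p0; set b := - p2 / p0; set c := - p3 / p0.
exists (causal_solution a b c); split; first exact: causal_solutionP.
apply: causal_solution_square_summable; rewrite -(pmulr_rgt0 _ p00) /a /b /c.
- by have -> : p0 * (1 - - p1 / p0 - - p2 / p0 - - p3 / p0) = p0 + p1 + p2 + p3 by field.
- by have -> : p0 * (1 - - p1 / p0 + - p2 / p0 + - p3 / p0) = p0 + p1 - p2 - p3 by field.
- by have -> : p0 * (1 + - p1 / p0 - - p2 / p0 + - p3 / p0) = p0 - p1 + p2 - p3 by field.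
- by have -> : p0 * (1 + - p1 / p0 + - p2 / p0 - - p3 / p0) = p0 - p1 - p2 + p3 by field.
Qed.

Lemma has_l2_solution_dominant {R : realType} (p0 p1 p2 p3 : R) :
  (0 < p0 + p1 + p2 + p3 /\ 0 < p0 + p1 - p2 - p3 /\
   0 < p0 - p1 + p2 - p3 /\ 0 < p0 - p1 - p2 + p3) \/
  (p0 + p1 + p2 + p3 < 0 /\ p0 + p1 - p2 - p3 < 0 /\
   p0 - p1 + p2 - p3 < 0 /\ p0 - p1 - p2 + p3 < 0) ->
  has_l2_solution p0 p1 p2 p3.
Proof.
move=> [[? [? [? ?]]]|[? [? [? ?]]]]; first exact: has_l2_solution_causal.
have e (x : R) : x = -1 * - x by ring.
rewrite (e p0) (e p1) (e p2) (e p3); apply: has_l2_solution_scale.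
  by rewrite oppr_eq0 oner_eq0.
by apply: has_l2_solution_causal; lra.
Qed.

(** A flip negates the third and fourth factors, and a swap exchanges the second and third. If
    exactly two factors are negative, the factor with the same sign as [f1] decides which axes to
    reflect so that all four signs agree: the first axis for [f2], the second for [f3], both for
    [f4]. *)
Lemma l2_solution_exists {R : realType} (a b c : R) :
  0 < (1 - a - b - c) * (1 - a + b + c) * (1 + a - b + c) * (1 + a + b - c) ->
  has_l2_solution 1 (- a) (- b) (- c).
Proof.
set f1 := 1 - a - b - c; set f2 := 1 - a + b + c.
set f3 := 1 + a - b + c; set f4 := 1 + a + b - c => D0.
have : (f1 != 0) && (f2 != 0) && (f3 != 0) && (f4 != 0).
  by move: D0; rewrite lt0r !mulf_eq0 !negb_or => /andP[].
move=> /andP[/andP[/andP[n1 n2] n3] n4].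
move: D0.
have [s1|s1|/eqP] := ltrgtP 0 f1; last by rewrite eq_sym (negbTE n1).
all: have [s2|s2|/eqP] := ltrgtP 0 f2; last by rewrite eq_sym (negbTE n2).
all: have [s3|s3|/eqP] := ltrgtP 0 f3; last by rewrite eq_sym (negbTE n3).
all: have [s4|s4|/eqP] := ltrgtP 0 f4; last by rewrite eq_sym (negbTE n4).
all: first [rewrite (pmulr_lgt0 _ s4) | rewrite (nmulr_lgt0 _ s4)].
all: first [rewrite (pmulr_lgt0 _ s3) | rewrite (nmulr_lgt0 _ s3)
          | rewrite (pmulr_llt0 _ s3) | rewrite (nmulr_llt0 _ s3)].
all: first [rewrite (pmulr_lgt0 _ s2) | rewrite (nmulr_lgt0 _ s2)
          | rewrite (pmulr_llt0 _ s2) | rewrite (nmulr_llt0 _ s2)] => D0.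
all: try by (exfalso; lra).
all: rewrite /f1 /f2 /f3 /f4 in s1 s2 s3 s4.
all: first [apply: has_l2_solution_dominant; lra
  | apply: has_l2_solution_flip; apply: has_l2_solution_dominant; lra
  | apply: has_l2_solution_swap; apply: has_l2_solution_flip; apply: has_l2_solution_dominant; lra
  | apply: has_l2_solution_flip; apply: has_l2_solution_swap;
    apply: has_l2_solution_flip; apply: has_l2_solution_dominant; lra].
Qed.

(** * No square-summable inverse when D <= 0 *)

Lemma torus_zero {R : realType} (a b c : R) :
  (1 - a - b - c) * (1 - a + b + c) * (1 + a - b + c) * (1 + a + b - c) <= 0 ->
  exists z1 z2 : R[i], [/\ `|z1| = 1, `|z2| = 1 &
    a%:C%C * z1 + b%:C%C * z2 + c%:C%C * (z1 * z2) = 1].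
Proof.
set D := (X in X <= 0) => D0.
pose p := 1 + a ^+ 2 - b ^+ 2 - c ^+ 2; pose q := 2 * (a + b * c).
have DE : D = p ^+ 2 - q ^+ 2 by rewrite /D /p /q; ring.
(* [t] is the future real part of [z1]. D <= 0 means p^2 <= q^2; if q = 0 then p = 0 too and [t] is
   free. *)
have [t [t1 qt]] : exists t : R, t ^+ 2 <= 1 /\ q * t = p.
  have [q0|q0] := eqVneq q 0.
    exists 1; split; first by rewrite expr1n.
    apply/esym/eqP; rewrite q0 mul0r -sqrf_eq0 eq_le sqr_ge0 andbT.
    by move: D0; rewrite DE q0; lra.
  exists (p / q); split; last by rewrite mulrC divfK.
  rewrite expr_div_n ler_pdivrMr ?mul1r; last by rewrite lt0r sqrf_eq0 q0 sqr_ge0.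
  by move: D0; rewrite DE; lra.
pose y := Num.sqrt (1 - t ^+ 2).
have y2 : y ^+ 2 = 1 - t ^+ 2 by rewrite sqr_sqrtr// subr_ge0.
have nrm (z : R[i]) (r : R) : 0 <= r -> complex.Re z ^+ 2 + complex.Im z ^+ 2 = r ^+ 2 ->
    `|z| = r%:C%C.
  by move=> r0 h; rewrite normc_def h sqrtr_sqr ger0_norm.
pose z1 : R[i] := (t +i* y)%C.
have z11 : `|z1| = 1 by apply: (nrm _ 1); rewrite ?ler01//= y2; ring.
pose u : R[i] := 1 - a%:C%C * z1; pose v : R[i] := b%:C%C + c%:C%C * z1.
have uE : u = ((1 - a * t) +i* (- (a * y)))%C.
  by apply/eqP; rewrite eq_complex /=; apply/andP; split; apply/eqP; ring.
have vE : v = ((b + c * t) +i* (c * y))%C.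
  by apply/eqP; rewrite eq_complex /=; apply/andP; split; apply/eqP; ring.
have uv : `|u| = `|v|.
  rewrite !normc_def uE vE /=; congr (Num.sqrt _)%:C%C.
  rewrite sqrrN !exprMn y2; move: qt; rewrite /q /p; lra.
(* The equation to solve is v z2 = u with |u| = |v|; if v = 0 then u = 0 and any z2 of modulus 1
   will do. *)
have [v0|v0] := eqVneq v 0.
  exists z1, 1; split=> //; first exact: normr1.
  have : u = 0 by apply/eqP; rewrite -normr_eq0 uv v0 normr0.
  rewrite !mulr1 -addrA -/v v0 addr0 => /eqP; rewrite subr_eq0 => /eqP <-//.
exists z1, (u / v); split=> //; first by rewrite normf_div uv divff// normr_eq0.
have -> : a%:C%C * z1 + b%:C%C * (u / v) + c%:C%C * (z1 * (u / v))
  = a%:C%C * z1 + v * (u / v) by rewrite /v; ring.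
by rewrite (mulrC v) divfK// /u; ring.
Qed.

(** The wave is the real part of z1^i z2^j; the coefficients are real, so the real part obeys the
    same recursion. The shifts go forward because summation by parts calls for the adjoint of
    Phi(shifts). *)
Lemma torus_wave {R : realType} (a b c : R) :
  (1 - a - b - c) * (1 - a + b + c) * (1 + a - b + c) * (1 + a + b - c) <= 0 ->
  exists w : int -> int -> R, [/\ w 0 0 = 1, forall i j, `|w i j| <= 1 &
    forall i j, w i j = a * w (i + 1) j + b * w i (j + 1) + c * w (i + 1) (j + 1)].
Proof.
move=> /torus_zero [z1 [z2 [n1 n2 zE]]].
have z10 : z1 != 0 by rewrite -normr_eq0 n1 oner_eq0.
have z20 : z2 != 0 by rewrite -normr_eq0 n2 oner_eq0.
exists (fun i j => complex.Re (z1 ^ i * z2 ^ j)); split.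
- by rewrite !expr0z mulr1.
- move=> i j; rewrite -lecR; apply: le_trans (normc_ge_Re _) _.
  have nz (z : R[i]) (k : int) : `|z| = 1 -> `|z ^ k| = 1.
    by move=> nz; case: k => n; rewrite ?NegzE -?exprnN -?exprnP ?normfV normrX nz
      expr1n ?invr1.
  by rewrite normrM !nz// mulr1.
move=> i j.
have ReM (x : R) (z : R[i]) : x * complex.Re z = complex.Re (x%:C%C * z).
  by case: z => z z'; rewrite /=; ring.
rewrite !ReM -!raddfD /=; congr complex.Re.
rewrite !expfzDr// !expr1z -[LHS]mulr1 -zE; ring.
Qed.

(** * Sums over symmetric ranges and over the sides of a square *)

Section intsum.
Context {R : realType}.
Implicit Types (f g : int -> R) (F : int -> int -> R) (n m : nat).

Lemma intsumS f n :
  intsum f n.+1 = intsum f n + (f (Posz n) + f (Negz n)).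
Proof. by rewrite /intsum big_ord_recr. Qed.

Lemma intsum0 f : intsum f 0 = 0.
Proof. by rewrite /intsum big_ord0. Qed.

Lemma intsumD f g n : intsum (fun i => f i + g i) n = intsum f n + intsum g n.
Proof. by elim: n => [|n IH]; rewrite ?intsum0 ?addr0 // !intsumS IH; ring. Qed.

Lemma intsumZ (k : R) f n : intsum (fun i => k * f i) n = k * intsum f n.
Proof. by elim: n => [|n IH]; rewrite ?intsum0 ?mulr0 // !intsumS IH; ring. Qed.

Lemma eq_intsum f g n : f =1 g -> intsum f n = intsum g n.
Proof. by move=> fg; apply: eq_bigr => i _; rewrite !fg. Qed.

Lemma le_intsum f g n : (forall i, f i <= g i) -> intsum f n <= intsum g n.
Proof. by move=> fg; apply: ler_sum => i _; exact: lerD. Qed.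

Lemma intsum_ge0 f n : (forall i, 0 <= f i) -> 0 <= intsum f n.
Proof. by move=> f0; apply: sumr_ge0 => i _; exact: addr_ge0. Qed.

Lemma ler_norm_intsum f n : `|intsum f n| <= intsum (fun i => `|f i|) n.
Proof.
apply: le_trans (ler_norm_sum _ _ _) _; apply: ler_sum => i _; exact: ler_normD.
Qed.

Lemma intsum_cst (k : R) n : intsum (fun=> k) n = k * (2 * n)%:R.
Proof. by rewrite /intsum sumr_const card_ord -mulr_natr natrM; ring. Qed.

Lemma intsum_delta f n : intsum (fun i => (i == 0)%:R * f i) n.+1 = f 0.
Proof.
elim: n => [|n IH]; rewrite intsumS ?intsum0 ?IH /=; last by rewrite !mul0r !addr0.
by rewrite mul1r mul0r add0r addr0.
Qed.

Lemma intsum_telescope f n :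
  intsum (fun i => f i - f (i - 1)) n.+1 = f (Posz n) - f (Negz n.+1).
Proof.
have Nz (m : nat) : Negz m - 1 = Negz m.+1 by rewrite !NegzE; ring.
elim: n => [|n IH]; rewrite intsumS ?intsum0 ?IH.
  by rewrite Nz (_ : Posz 0 - 1 = Negz 0) //; ring.
by rewrite Nz (_ : Posz n.+1 - 1 = Posz n); [ring | rewrite -addn1 PoszD addrK].
Qed.

Lemma le_intsum_size f m n : (forall i, 0 <= f i) -> (m <= n)%N ->
  intsum f m <= intsum f n.
Proof.
move=> f0 /subnK <-; elim: (n - m)%N => // k IH; rewrite addSn intsumS.
by apply: le_trans IH _; rewrite lerDl addr_ge0.
Qed.

(** The shifted range [- n - 2, n - 1] lies inside [- n - 2, n + 1]. *)
Lemma le_intsum_shift f n : (forall i, 0 <= f i) ->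
  intsum (fun i => f (i - 1)) n.+1 <= intsum f n.+2.
Proof.
move=> f0; have := intsum_telescope f n.
rewrite intsumD.
have -> : intsum (fun i => - f (i - 1)) n.+1 = - intsum (fun i => f (i - 1)) n.+1.
  rewrite -[RHS]mulN1r -intsumZ; apply: eq_intsum => i; ring.
move=> tel; rewrite [leRHS]intsumS; have := f0 (Posz n.+1); have := f0 (Posz n); lra.
Qed.

(* Columns m and - m - 2 (resp. rows), summed over a range large enough to
   contain the shifted side produced by the diagonal term [c]. *)
Definition vertical_sides F m : R :=
  intsum (fun j => F (Posz m) j + F (Negz m.+1) j) m.+2.

Definition horizontal_sides F m : R :=
  intsum (fun i => F i (Posz m) + F i (Negz m.+1)) m.+2.

(** For m < n the columns m and - m - 2 are pairwise distinct and lie in [- n - 1, n]; only the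
    columns n and - 1 are left out. *)
Lemma sum_vertical_sides F n : (forall i j, 0 <= F i j) ->
  \sum_(m < n) vertical_sides F m <= intsum (fun i => intsum (F i) n.+1) n.+1.
Proof.
move=> f0; have fi i k : 0 <= intsum (F i) k by apply: intsum_ge0.
apply: (@le_trans _ _ (\sum_(m < n) (intsum (F (Posz m)) n.+1 + intsum (F (Negz m.+1)) n.+1))).
  apply: ler_sum => m _; rewrite /vertical_sides intsumD.
  by apply: lerD; apply: le_intsum_size => //; rewrite ltnS.
rewrite /intsum !big_split /= -!/(intsum _ _); apply: lerD.
  by rewrite [leRHS]big_ord_recr /= lerDl fi.
by rewrite [leRHS]big_ord_recl /= lerDr fi.
Qed.

Lemma exchange_intsum F n :
  intsum (fun i => intsum (fun j => F i j) n) n = intsum (fun j => intsum (fun i => F i j) n) n.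
Proof.
rewrite /intsum; under eq_bigr do rewrite -big_split.
by rewrite exchange_big /=; apply: eq_bigr => j _; rewrite -big_split /=;
  apply: eq_bigr => i _; ring.
Qed.

Lemma sum_horizontal_sides F n : (forall i j, 0 <= F i j) ->
  \sum_(m < n) horizontal_sides F m <= intsum (fun i => intsum (F i) n.+1) n.+1.
Proof.
move=> f0; rewrite (exchange_intsum F).
exact: (@sum_vertical_sides (fun i j => F j i) n).
Qed.

End intsum.

Section nonexistence.
Context {R : realType} (a b c : R) (w psi : int -> int -> R).
Hypothesis w00 : w 0 0 = 1.
Hypothesis w_le1 : forall i j, `|w i j| <= 1.
Hypothesis wE : forall i j,
  w i j = a * w (i + 1) j + b * w i (j + 1) + c * w (i + 1) (j + 1).
Hypothesis psi_fs : fundamental_solution 1 (- a) (- b) (- c) psi.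

Let norm_psi i j := `|psi i j|.

Lemma norm_wpsi_le i j k l : `|w i j * psi k l| <= norm_psi k l.
Proof. by rewrite normrM -[leRHS]mul1r ler_wpM2r. Qed.

(* Summation by parts of [w * delta] leaves only terms on the sides. *)
Lemma sides_ge1 m :
  1 <= (`|a| + `|b| + `|c|) * (vertical_sides norm_psi m + horizontal_sides norm_psi m).
Proof.
pose A i j := w (i + 1) j * psi i j.
pose B i j := w i (j + 1) * psi i j.
pose C i j := w (i + 1) (j + 1) * psi i j.
pose n := m.+1.
have dA (f : int -> int -> R) : intsum (fun i => intsum (fun j => f i j - f (i - 1) j) n) n
    = intsum (fun j => f (Posz m) j - f (Negz m.+1) j) n.
  by rewrite exchange_intsum; apply: eq_intsum => j; rewrite (intsum_telescope (f^~ j)).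
have dB (f : int -> int -> R) : intsum (fun i => intsum (fun j => f i j - f i (j - 1)) n) n
    = intsum (fun i => f i (Posz m) - f i (Negz m.+1)) n.
  by apply: eq_intsum => i; rewrite intsum_telescope.
(* The diagonal difference C i j - C (i - 1) (j - 1) is split as a step in i followed by a step in j
   along column i - 1, hence two terms in c. *)
have sum1 : 1 = a * intsum (fun j => A (Posz m) j - A (Negz m.+1) j) n
    + b * intsum (fun i => B i (Posz m) - B i (Negz m.+1)) n
    + c * intsum (fun j => C (Posz m) j - C (Negz m.+1) j) n
    + c * intsum (fun i => C (i - 1) (Posz m) - C (i - 1) (Negz m.+1)) n.
  rewrite -dA -dB -(dA C) -(dB (fun i => C (i - 1))).
  transitivity (intsum (fun i => (i == 0)%:R * intsum (fun j => (j == 0)%:R * w i j) n) n).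
    by rewrite intsum_delta intsum_delta w00.
  rewrite -!intsumZ -!intsumD; apply: eq_intsum => i.
  rewrite -!intsumZ -!intsumD; apply: eq_intsum => j.
  (* The adjoint recursion is applied only to the [w i j] that multiplies [psi i j]; each resulting
     term then pairs with a shifted one. *)
  rewrite mulrA -natrM mulnb -psi_fs /A /B /C !subrK.
  rewrite mul1r !mulrDl {1}(wE i j); ring.
have np0 i j : 0 <= norm_psi i j by exact: normr_ge0.
have mn : (n <= m.+2)%N by [].
have sideV (f : int -> int -> R) : (forall i j, `|f i j| <= norm_psi i j) ->
    `|intsum (fun j => f (Posz m) j - f (Negz m.+1) j) n| <= vertical_sides norm_psi m.
  move=> fle; apply: le_trans (ler_norm_intsum _ _) _.
  apply: le_trans (le_intsum_size _ mn) => [|j]; last by rewrite addr_ge0.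
  by apply: le_intsum => j; apply: le_trans (ler_normB _ _) _; exact: lerD.
have sideH (f : int -> int -> R) : (forall i j, `|f i j| <= norm_psi i j) ->
    `|intsum (fun i => f i (Posz m) - f i (Negz m.+1)) n| <= horizontal_sides norm_psi m.
  move=> fle; apply: le_trans (ler_norm_intsum _ _) _.
  apply: le_trans (le_intsum_size _ mn) => [|j]; last by rewrite addr_ge0.
  by apply: le_intsum => j; apply: le_trans (ler_normB _ _) _; exact: lerD.
have sideH' : `|intsum (fun i => C (i - 1) (Posz m) - C (i - 1) (Negz m.+1)) n|
    <= horizontal_sides norm_psi m.
  apply: le_trans (ler_norm_intsum _ _) _.
  apply: le_trans (le_intsum_shift (f := fun i => norm_psi i m + norm_psi i (Negz m.+1)) m _).
    by apply: le_intsum => j; apply: le_trans (ler_normB _ _) _; apply: lerD; exact: norm_wpsi_le.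
  by move=> i; rewrite addr_ge0.
have V0 : 0 <= vertical_sides norm_psi m by apply: intsum_ge0 => j; rewrite addr_ge0.
have H0 : 0 <= horizontal_sides norm_psi m by apply: intsum_ge0 => j; rewrite addr_ge0.
rewrite -[leLHS](normr1 R) sum1.
apply: le_trans (ler_normD _ _) _; rewrite normrM.
apply: le_trans (lerD (ler_normD _ _) (lexx _)) _; rewrite normrM.
apply: le_trans (lerD (lerD (ler_normD _ _) (lexx _)) (lexx _)) _; rewrite !normrM.
have hA := ler_wpM2l (normr_ge0 a) (sideV A (fun i j => norm_wpsi_le _ _ i j)).
have hB := ler_wpM2l (normr_ge0 b) (sideH B (fun i j => norm_wpsi_le _ _ i j)).
have hC := ler_wpM2l (normr_ge0 c) (sideV C (fun i j => norm_wpsi_le _ _ i j)).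
have hD := ler_wpM2l (normr_ge0 c) sideH'.
have := mulr_ge0 (normr_ge0 a) H0; have := mulr_ge0 (normr_ge0 b) V0.
by rewrite !mulrDl !mulrDr; lra.
Qed.

Let sqr_psi i j := psi i j ^+ 2.

(* AM-GM: [2 |x| <= l x^2 + 1 / l] on each of the [8 (m + 2)] boundary points. *)
Lemma sides_sqr_ge m :
  (8 * (`|a| + `|b| + `|c|) ^+ 2)^-1 * harmonic m.+1
  <= vertical_sides sqr_psi m + horizontal_sides sqr_psi m.
Proof.
set K := `|a| + `|b| + `|c|; have K1 := sides_ge1 m; rewrite -/K in K1.
have Kge0 : 0 <= K by rewrite !addr_ge0.
have K0 : 0 < K.
  by rewrite lt_neqAle Kge0 andbT; apply/eqP => k0; move: K1; rewrite -k0 mul0r; lra.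
set M : R := m.+2%:R.
have M0 : 0 < M by rewrite ltr0n.
(* With this [l] the constants of AM-GM contribute K (4 M / l) = 1 / 2, half of the lower bound
   1. *)
pose l := 8 * K * M.
have l0 : 0 < l by rewrite !mulr_gt0.
have amgm (x : R) : `|x| <= l / 2 * x ^+ 2 + (2 * l)^-1.
  rewrite -subr_ge0.
  have -> : l / 2 * x ^+ 2 + (2 * l)^-1 - `|x| = (2 * l)^-1 * (l * `|x| - 1) ^+ 2.
    rewrite -(real_normK (num_real x)); field; exact: lt0r_neq0.
  by rewrite mulr_ge0 ?sqr_ge0// invr_ge0 mulr_ge0// ltW.
have avg (f g : int -> R) : intsum (fun j => `|f j| + `|g j|) m.+2 <=
    l / 2 * intsum (fun j => f j ^+ 2 + g j ^+ 2) m.+2 + 2 * M / l.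
  have -> : 2 * M / l = intsum (fun=> (2 * l)^-1 + (2 * l)^-1) m.+2.
    rewrite intsum_cst natrM -/M; field; exact: lt0r_neq0.
  rewrite -intsumZ -intsumD; apply: le_intsum => j.
  by have := amgm (f j); have := amgm (g j); lra.
have hV := avg (psi (Posz m)) (psi (Negz m.+1)).
have hH := avg (psi^~ (Posz m)) (psi^~ (Negz m.+1)).
set Q := vertical_sides sqr_psi m + horizontal_sides sqr_psi m.
have hQ : vertical_sides norm_psi m + horizontal_sides norm_psi m <= l / 2 * Q + 4 * M / l.
  apply: le_trans (lerD hV hH) _; rewrite /Q /vertical_sides /horizontal_sides /sqr_psi; lra.
have {}hQ := le_trans K1 (ler_wpM2l Kge0 hQ).
have hl : K * (l / 2 * Q + 4 * M / l) = 4 * K ^+ 2 * M * Q + 1 / 2.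
  by rewrite /l; field; rewrite !lt0r_neq0.
rewrite hl in hQ.
have KM : 0 < 8 * K ^+ 2 * M by rewrite !mulr_gt0// exprn_gt0.
rewrite /= -/M -invfM -[leLHS]mul1r ler_pdivrMr//; lra.
Qed.

Lemma not_square_summable : ~ square_summable psi.
Proof.
move=> [L psiL]; pose K := `|a| + `|b| + `|c|.
have K1 := sides_ge1 0; rewrite -/K in K1.
have K0 : K != 0 by apply/eqP => k0; move: K1; rewrite k0 mul0r; lra.
have K8 : 0 < 8 * K ^+ 2 by rewrite mulr_gt0// exprn_even_gt0.
apply: (@dvg_harmonic R); apply: nondecreasing_is_cvgn.
  by apply: nondecreasing_series => n _ _; exact: harmonic_ge0.
(* The 1 is the first harmonic term, which the sides do not bound; the vertical and the horizontal
   sides contribute one [L] each. *)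
exists (1 + 8 * K ^+ 2 * (L + L)) => _ [n _ <-].
apply: (@le_trans _ _ (series harmonic n.+1)).
  by rewrite seriesSr /= lerDl invr_ge0.
rewrite /series /= big_mkord big_ord_recl /= invr1 lerD2l.
rewrite -ler_pdivrMl// mulr_sumr.
apply: (@le_trans _ _ (\sum_(m < n) (vertical_sides sqr_psi m + horizontal_sides sqr_psi m))).
  apply: ler_sum => m _; exact: (sides_sqr_ge m).
rewrite big_split /=; apply: lerD.
  by apply: le_trans (psiL n.+1); apply: sum_vertical_sides => i j; exact: sqr_ge0.
by apply: le_trans (psiL n.+1); apply: sum_horizontal_sides => i j; exact: sqr_ge0.
Qed.

End nonexistence.

Lemma no_l2_solution {R : realType} (a b c : R) :
  (1 - a - b - c) * (1 - a + b + c) * (1 + a - b + c) * (1 + a + b - c) <= 0 ->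
  ~ has_l2_solution 1 (- a) (- b) (- c).
Proof.
move=> /torus_wave [w [w00 w_le1 wE]] [psi [psi_fs]].
exact: (not_square_summable w00 w_le1 wE psi_fs).
Qed.

(** * White noise on a countable probability space *)

Definition ints (n : nat) : seq int :=
  [seq Posz i | i <- iota 0 n] ++ [seq Negz i | i <- iota 0 n].

Definition box (n : nat) : seq (int * int) := [seq (i, j) | i <- ints n, j <- ints n].

Lemma ints_uniq n : uniq (ints n).
Proof.
rewrite cat_uniq !map_inj_uniq ?iota_uniq //= ?andbT; try by move=> ? ? [].
by apply/hasPn => _ /mapP[i _ ->]; apply/mapP => -[].
Qed.

Lemma box_uniq n : uniq (box n).
Proof. by apply: allpairs_uniq; rewrite ?ints_uniq // => -[? ?] [? ?] _ _ [-> ->]. Qed.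

Lemma mem_ints (i : int) n : (`|i| < n)%N -> i \in ints n.
Proof.
rewrite mem_cat; case: i => m /= hm; apply/orP; [left|right]; apply: map_f; rewrite mem_iota //=.
exact: ltnW hm.
Qed.

Lemma intsum_ints {R : realType} (f : int -> R) n : intsum f n = \sum_(i <- ints n) f i.
Proof.
rewrite /intsum /ints.
have -> : iota 0 n = index_iota 0 n by rewrite /index_iota subn0.
by rewrite big_cat /= !big_map !big_mkord -big_split.
Qed.

Lemma intsum_box {R : realType} (F : int -> int -> R) n :
  intsum (fun i => intsum (F i) n) n = \sum_(k <- box n) F k.1 k.2.
Proof.
rewrite intsum_ints big_allpairs_dep /=; apply: eq_bigr => i _.
by rewrite intsum_ints.
Qed.

(** Every finite subset of Z^2 lies in a box, so a bound on all boxes bounds [\esum]. *)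
Lemma ler_sum_box {R : realType} (F : int * int -> R) (s : seq (int * int)) :
  (forall k, 0 <= F k) -> uniq s ->
  exists n, \sum_(k <- s) F k <= \sum_(k <- box n) F k.
Proof.
move=> F0 us.
exists (\max_(k <- s) (maxn `|k.1| `|k.2|)).+1; set n := (X in X.+1).
have sb k : k \in s -> k \in box n.+1.
  move=> ks; have kn : (maxn `|k.1| `|k.2| <= n)%N.
    by rewrite /n (big_rem k ks) leq_maxl.
  rewrite (surjective_pairing k) allpairs_f // mem_ints // ltnS (leq_trans _ kn) //.
    exact: leq_maxl.
  exact: leq_maxr.
rewrite [leRHS](bigID (mem s)) /= -[X in _ <= X + _]big_filter.
have /(perm_big _) -> : perm_eq [seq k <- box n.+1 | k \in s] s.
  apply: uniq_perm => //; first by rewrite filter_uniq ?box_uniq.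
  by move=> k; rewrite mem_filter andb_idr //; exact: sb.
by rewrite lerDl sumr_ge0.
Qed.

Lemma square_summable_esum {R : realType} (psi : int -> int -> R) :
  square_summable psi ->
  (\esum_(k in [set: int * int]) (psi k.1 k.2 ^+ 2)%:E < +oo)%E.
Proof.
move=> [K psiK]; apply: (@le_lt_trans _ _ K%:E); last exact: ltry.
apply: ge_ereal_sup => _ [A [finA _] <-].
rewrite fsbig_finite//= sumEFin lee_fin.
have [|n] := ler_sum_box (F := fun k => psi k.1 k.2 ^+ 2) _ (finmap.fset_uniq (fset_set A)).
  by move=> k; exact: sqr_ge0.
by move/le_trans; apply; rewrite -(intsum_box (fun i j => psi i j ^+ 2)).
Qed.

#[local] HB.instance Definition _ := isPointed.Build int 0.

Lemma int2_enumeration : exists e : nat -> int * int, set_bij setT setT e.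
Proof.
have card : ([set: nat] #= [set: int * int])%card.
  apply: card_esym; apply: eq_card_nat; first exact: countableP.
  apply/infiniteP; apply/pcard_injP.
  by exists (fun n => (Posz n, Posz 0)) => m n _ _ [].
exact: (elimT card_set_bijP card).
Qed.

Section paired_geometric.
Context {R : realType}.

(** The exponent makes the total mass 1: each weight is used twice, and the numbers 2^-(m + 1) sum
    to 1. *)
Definition pair_weight (m : nat) : R := 1 / (2 ^ (m + 2))%:R.

Lemma pair_weight_gt0 m : 0 < pair_weight m.
Proof. by rewrite divr_gt0// ltr0n expn_gt0. Qed.

(* The atoms [2 m] and [2 m + 1] carry the same mass, so that a function which
   is antisymmetric on each such pair has zero mean. *)
Definition pair_measure (m : nat) : {measure set nat -> \bar R} :=
  mscale (NngNum (ltW (pair_weight_gt0 m)))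
    (measure_add (dirac m.*2) (dirac m.*2.+1)).

Definition paired_geometric : set nat -> \bar R := mseries pair_measure 0.

HB.instance Definition _ := Measure.on paired_geometric.

Lemma ge0_integral_paired_geometric (g : nat -> \bar R) : (forall n, 0 <= g n)%E ->
  (\int[paired_geometric]_n g n =
   \sum_(m <oo) (pair_weight m)%:E * (g m.*2 + g m.*2.+1))%E.
Proof.
move=> g0; rewrite ge0_integral_measure_series //.
apply: eq_eseriesr => m _.
rewrite ge0_integral_mscale //= ge0_integral_measure_add //.
by rewrite !integral_dirac // !diracT !mul1e.
Qed.

Lemma paired_geometric_setT : paired_geometric setT = 1%E.
Proof.
rewrite -[LHS]mul1e -integral_cst // ge0_integral_paired_geometric //.
rewrite (@eq_eseriesr _ _ (fun m => (1 / (2 ^ (m + 1))%:R)%:E)); last first.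
  move=> m _; rewrite /cst /= -EFinD -EFinM /pair_weight; congr EFin.
  by rewrite addnS expnS natrM; field; rewrite pnatr_eq0 expn_eq0.
by apply/cvg_lim => //; have := @cvg_geometric_eseries_half R 1 0; rewrite divr1.
Qed.

HB.instance Definition _ :=
  @Measure_isProbability.Build _ _ R paired_geometric paired_geometric_setT.

End paired_geometric.

Section white_noise.
Context {R : realType} (e : nat -> int * int).
Hypothesis e_bij : set_bij setT setT e.
Local Notation P := (@paired_geometric R).
Implicit Types phi chi : int * int -> R.

(* Normalized so that [phi] has l2 norm equal to the L2 norm of its image; the
   variables attached to the points of Z^2 have disjoint supports. *)
Definition noise_integral phi (n : nat) : R :=
  (-1) ^+ odd n * (phi (e n./2) / Num.sqrt (2 * pair_weight n./2)).

Lemma measurable_noise_integral phi : measurable_fun setT (noise_integral phi).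
Proof. by []. Qed.

HB.instance Definition _ phi :=
  isMeasurableFun.Build _ _ nat R (noise_integral phi) (measurable_noise_integral phi).

Lemma noise_integral_even phi m :
  noise_integral phi m.*2 = phi (e m) / Num.sqrt (2 * pair_weight m).
Proof. by rewrite /noise_integral odd_double doubleK expr0 mul1r. Qed.

Lemma noise_integral_odd phi m :
  noise_integral phi m.*2.+1 = - (phi (e m) / Num.sqrt (2 * pair_weight m)).
Proof. by rewrite /noise_integral oddS odd_double /= uphalf_double expr1 mulN1r. Qed.

Lemma noise_integralD phi chi :
  noise_integral (phi \+ chi) = noise_integral phi \+ noise_integral chi.
Proof. by apply/funext => n; rewrite /noise_integral /=; ring. Qed.

(** An isometry: the two atoms of pair m have joint mass 2 [pair_weight m], which cancels the
    squared normalization. *)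
Lemma integral_noise_integral_sqr phi :
  (\int[P]_n (noise_integral phi n ^+ 2)%:E = \esum_(k in setT) (phi k ^+ 2)%:E)%E.
Proof.
rewrite ge0_integral_paired_geometric; last by move=> n; rewrite lee_fin sqr_ge0.
rewrite (reindex_esum setT setT e) // -nneseries_esumT; last first.
  by move=> n; rewrite lee_fin sqr_ge0.
apply: eq_eseriesr => m _; rewrite -EFinD -EFinM; congr EFin.
rewrite noise_integral_even noise_integral_odd sqrrN exprMn exprVn sqr_sqrtr; last first.
  by rewrite mulr_ge0// ltW// pair_weight_gt0.
by field; rewrite gt_eqF// pair_weight_gt0.
Qed.

Definition l2_field phi : Prop := (\esum_(k in setT) (phi k ^+ 2)%:E < +oo)%E.

Lemma noise_integral_Lfun2 phi : l2_field phi -> noise_integral phi \in Lfun P 2%:E.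
Proof.
move=> l2; apply/andP; split; rewrite inE /=; first exact: measurable_funPT.
rewrite /finite_norm unlock poweR_lty //.
under eq_integral => n _ do rewrite /= powR_mulrn ?normr_ge0 // real_normK ?num_real //.
by rewrite integral_noise_integral_sqr.
Qed.

(** The sign change within each pair gives the positive and negative parts equal integrals; square
    integrability makes the mean finite, which excludes the difference of two infinities. *)
Lemma expectation_noise_integral phi : l2_field phi -> ('E_P[noise_integral phi] = 0)%E.
Proof.
move=> l2.
have fin : ('E_P[noise_integral phi] \is a fin_num)%E.
  by apply: expectation_fin_num; apply: Lfun_subset12 (noise_integral_Lfun2 l2);
    exact: fin_num_measure.
have EE : ('E_P[noise_integral phi] = \int[P]_n (noise_integral phi n)%:E)%E.
  exact: expectation_def.
set f := EFin \o noise_integral phi.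
have sym : (\int[P]_n f^\+ n = \int[P]_n f^\- n)%E.
  rewrite !ge0_integral_paired_geometric //.
  apply: eq_eseriesr => m _; rewrite !funeposE !funenegE /f /=.
  rewrite noise_integral_even noise_integral_odd.
  by rewrite opprK addeC.
have := EE; rewrite integralE -/f sym => EE'.
move: fin; rewrite EE' => fin; apply: subee.
by move: fin; rewrite fin_numB andbb.
Qed.

Lemma variance_noise_integral phi : l2_field phi ->
  ('V_P[noise_integral phi] = \esum_(k in setT) (phi k ^+ 2)%:E)%E.
Proof.
move=> l2; rewrite varianceE ?noise_integral_Lfun2 // expectation_noise_integral //.
rewrite expe2 mul0e sube0 -integral_noise_integral_sqr unlock.
by apply: eq_integral.
Qed.

Lemma l2_fieldD phi chi : l2_field phi -> l2_field chi -> l2_field (phi \+ chi).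
Proof.
move=> l2p l2c; rewrite /l2_field -integral_noise_integral_sqr noise_integralD.
have : noise_integral phi + noise_integral chi \in Lfun P 2%:E.
  by apply: rpredD; rewrite ?lee1n // => ?; exact: noise_integral_Lfun2.
by move/Lfun2_integrable_sqr/integrable_lty; exact.
Qed.

Lemma esum_sqr_fin_num phi : l2_field phi ->
  (\esum_(k in setT) (phi k ^+ 2)%:E)%E \is a fin_num.
Proof.
by move=> l2; rewrite ge0_fin_numE // esum_ge0 // => k _; rewrite lee_fin sqr_ge0.
Qed.

Lemma covariance_noise_integral_fin_num phi chi : l2_field phi -> l2_field chi ->
  covariance P (noise_integral phi) (noise_integral chi) \is a fin_num.
Proof.
move=> l2p l2c.
have Pfin : P setT \is a fin_num by rewrite probability_setT.
apply: covariance_fin_num; first exact: Lfun_subset12 (noise_integral_Lfun2 l2p).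
  exact: Lfun_subset12 (noise_integral_Lfun2 l2c).
by apply: Lfun2_mul_Lfun1; exact: noise_integral_Lfun2.
Qed.

(** Polarization expresses covariances through sums of squares, so that no signed infinite sum on
    the lattice has to be handled. *)
Lemma covariance_noise_integral phi chi : l2_field phi -> l2_field chi ->
  (2%:E * covariance P (noise_integral phi) (noise_integral chi) =
   \esum_(k in setT) ((phi k + chi k) ^+ 2)%:E
   - (\esum_(k in setT) (phi k ^+ 2)%:E + \esum_(k in setT) (chi k ^+ 2)%:E))%E.
Proof.
move=> l2p l2c.
have := varianceD (noise_integral_Lfun2 l2p) (noise_integral_Lfun2 l2c).
rewrite -noise_integralD !variance_noise_integral //; last exact: l2_fieldD.
move=> ->; rewrite [RHS]addeC addeA [X in (X + _)%E]addeC subee ?add0e //.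
by rewrite fin_numD !esum_sqr_fin_num.
Qed.

Lemma covariance_noise_integral_orthogonal phi chi : l2_field phi -> l2_field chi ->
  (forall k, phi k * chi k = 0) ->
  covariance P (noise_integral phi) (noise_integral chi) = 0%E.
Proof.
move=> l2p l2c pc0.
have := covariance_noise_integral l2p l2c.
rewrite (@eq_esum _ _ _ _ (fun k => (phi k ^+ 2)%:E + (chi k ^+ 2)%:E)%E); last first.
  by move=> k _; rewrite -EFinD; congr EFin; rewrite sqrrD pc0 mul0rn addr0.
rewrite esumD; try by move=> k _; rewrite lee_fin sqr_ge0.
rewrite subee; last by rewrite fin_numD !esum_sqr_fin_num.
by move/eqP; rewrite mule_eq0 eqe pnatr_eq0 /= => /eqP.
Qed.

Lemma esum_comp (tau : int * int -> int * int) (F : int * int -> \bar R) :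
  bijective tau -> (forall k, 0 <= F k)%E ->
  (\esum_(k in setT) F (tau k) = \esum_(k in setT) F k)%E.
Proof.
move=> [tau' tauK tauK'] F0; rewrite -(reindex_esum setT setT tau) //.
split=> // [x y _ _ /(can_inj tauK)//|y _]; by exists (tau' y).
Qed.

Lemma l2_field_comp (tau : int * int -> int * int) phi :
  bijective tau -> l2_field phi -> l2_field (phi \o tau).
Proof.
move=> tau_bij; rewrite /l2_field (esum_comp (tau := tau) (F := fun k => (phi k ^+ 2)%:E)) //.
by move=> k; rewrite lee_fin sqr_ge0.
Qed.

(** For a translation [tau] this is the source of stationarity. *)
Lemma covariance_noise_integral_comp (tau : int * int -> int * int) phi chi :
  bijective tau -> l2_field phi -> l2_field chi ->
  covariance P (noise_integral (phi \o tau)) (noise_integral (chi \o tau)) =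
  covariance P (noise_integral phi) (noise_integral chi).
Proof.
move=> tau_bij l2p l2c.
have l2p' := l2_field_comp tau_bij l2p; have l2c' := l2_field_comp tau_bij l2c.
have ge0 (f : int * int -> R) k : (0 <= (f k ^+ 2)%:E)%E by rewrite lee_fin sqr_ge0.
have := covariance_noise_integral l2p' l2c'.
rewrite (esum_comp (tau := tau) (F := fun k => ((phi k + chi k) ^+ 2)%:E)) //;
  last exact: (ge0 (phi \+ chi)).
rewrite (esum_comp (tau := tau) (F := fun k => (phi k ^+ 2)%:E)) //.
rewrite (esum_comp (tau := tau) (F := fun k => (chi k ^+ 2)%:E)) //.
rewrite -covariance_noise_integral // => cov2.
move: cov2; rewrite -(fineK (covariance_noise_integral_fin_num l2p' l2c')).
rewrite -(fineK (covariance_noise_integral_fin_num l2p l2c)) -!EFinM => -[/mulfI ->] //.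
Qed.

End white_noise.

Lemma esum_sqr_delta {R : realType} (s : R) (p : int * int) :
  (\esum_(k in setT) ((s * (k == p)%:R) ^+ 2)%:E = (s ^+ 2)%:E)%E.
Proof.
rewrite -[RHS](@esum_set1 R (int * int)%type p (fun=> (s ^+ 2)%:E)); last first.
  by rewrite lee_fin sqr_ge0.
rewrite [RHS]esum_mkcond; apply: eq_esum => k _.
have [->|kp] := eqVneq k p; first by rewrite mulr1 mem_set.
by rewrite mulr0 expr0n memNset //= => kp'; rewrite kp' eqxx in kp.
Qed.

(** X is the moving average whose coefficient at k, for the point p, is psi (p - k), relative to
    noise of unit variance. *)
Lemma stationary_field_exists {R : realType} (sigma a b c : R) : sigma != 0 ->
  has_l2_solution 1 (- a) (- b) (- c) ->
  exists (d : measure_display) (T : measurableType d) (P : probability T R)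
         (eps X : int -> int -> {RV P >-> R}),
     [/\ uncorrelated_noise (sigma ^+ 2) eps,
         wide_sense_stationary X &
         satisfies_recursion a b c eps X].
Proof.
(* Scaling the coefficients by [sigma^-1] yields Phi(shifts) psi = sigma delta, in line with [delta]
   below. *)
move=> s0 /(has_l2_solution_scale (invr_neq0 s0)) [psi [psi_fs psi_l2]].
have [e e_bij] := int2_enumeration.
pose delta p (k : int * int) : R := sigma * (k == p)%:R.
pose shift p (k : int * int) := psi (p.1 - k.1) (p.2 - k.2).
have delta_l2 p : l2_field (delta p) by rewrite /l2_field esum_sqr_delta ltry.
have flip_bij i j : bijective (fun k : int * int => (i - k.1, j - k.2)).
  by apply: (@Bijective _ _ _ (fun k => (i - k.1, j - k.2))) => -[x y] /=; congr (_, _); ring.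
have shift_l2 p : l2_field (shift p).
  exact: (l2_field_comp (phi := fun k => psi k.1 k.2) (flip_bij p.1 p.2)
    (square_summable_esum psi_l2)).
exists default_measure_display, nat, (@paired_geometric R : probability nat R),
  (fun i j => noise_integral e (delta (i, j)) : {RV _ >-> R}),
  (fun i j => noise_integral e (shift (i, j)) : {RV _ >-> R}); split.
- split=> [i j|i j|i j|i j k l ne].
  + exact: noise_integral_Lfun2.
  + exact: expectation_noise_integral.
  + by rewrite variance_noise_integral // esum_sqr_delta.
  + apply: covariance_noise_integral_orthogonal => // m; rewrite /delta.
    have [->|] := eqVneq m (i, j); last by rewrite mulr0 mul0r.
    by rewrite (introF eqP ne) !mulr0.
- split=> [i j|i j i' j'|h1 h2 i j i' j'].
  + exact: noise_integral_Lfun2.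
  + by rewrite !expectation_noise_integral.
  pose tau (k : int * int) := (k.1 - (i - i'), k.2 - (j - j')).
  have tau_bij : bijective tau.
    apply: (@Bijective _ _ _ (fun k => (k.1 + (i - i'), k.2 + (j - j')))) => -[x y] /=;
      rewrite /tau /=; congr (_, _); ring.
  rewrite -(covariance_noise_integral_comp e_bij tau_bij
    (shift_l2 (i', j')) (shift_l2 (i' - h1, j' - h2))).
  congr (covariance _ (noise_integral e _) (noise_integral e _)); apply/funext => -[x y];
    rewrite /shift /tau /=; congr psi; ring.
(* The recursion holds at every outcome: outcome [n] sees only the lattice point [e n./2], where it
   is the equation for psi. *)
move=> i j; apply: aeW => n /=; rewrite /noise_integral.
set k := e n./2; set t := Num.sqrt _.
suff -> : shift (i, j) k = a * shift (i - 1, j) k + b * shift (i, j - 1) k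
    + c * shift (i - 1, j - 1) k + delta (i, j) k by ring.
have kE : (k == (i, j)) = (i - k.1 == 0) && (j - k.2 == 0).
  by rewrite [k in LHS]surjective_pairing xpair_eqE !subr_eq0 ![_.1 == _]eq_sym ![_.2 == _]eq_sym.
rewrite /shift /delta kE -psi_fs /= ![_ - 1 - _]addrAC.
by field.
Qed.

(** * From a stationary field to a square-summable inverse *)

Section real_covariance.
Context {R : realType} d (T : measurableType d) (P : probability T R).
Implicit Types X Y Z : T -> R.

Definition rcov X Y : R := fine (covariance P X Y).

Lemma rcovC X Y : rcov X Y = rcov Y X.
Proof. by rewrite /rcov covarianceC. Qed.

Let Lfun21 X : X \in Lfun P 2%:E -> X \in Lfun P 1.
Proof. by apply: Lfun_subset12; exact: fin_num_measure. Qed.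

Lemma covariance_rcov X Y : X \in Lfun P 2%:E -> Y \in Lfun P 2%:E ->
  covariance P X Y = (rcov X Y)%:E.
Proof.
move=> X2 Y2; rewrite /rcov fineK //; apply: covariance_fin_num; try exact: Lfun21.
exact: Lfun2_mul_Lfun1.
Qed.

Lemma rcovDl X Y Z : X \in Lfun P 2%:E -> Y \in Lfun P 2%:E -> Z \in Lfun P 2%:E ->
  rcov (X \+ Y) Z = rcov X Z + rcov Y Z.
Proof.
by move=> X2 Y2 Z2; rewrite {1}/rcov covarianceDl // !covariance_rcov.
Qed.

Lemma rcovZl t X Y : X \in Lfun P 2%:E -> Y \in Lfun P 2%:E ->
  rcov (t \o* X) Y = t * rcov X Y.
Proof.
move=> X2 Y2.
rewrite {1}/rcov covarianceZl; try exact: Lfun21.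
  by rewrite covariance_rcov.
exact: Lfun2_mul_Lfun1.
Qed.

Lemma Lfun2_scale t X : X \in Lfun P 2%:E -> t \o* X \in Lfun P 2%:E.
Proof. by apply: Lfun_scale; rewrite ler1n. Qed.

Lemma Lfun2D X Y : X \in Lfun P 2%:E -> Y \in Lfun P 2%:E -> X \+ Y \in Lfun P 2%:E.
Proof. by move=> X2 Y2; apply: rpredD; rewrite ?lee1n. Qed.

Lemma rcov_ge0 X : 0 <= rcov X X.
Proof. by apply: fine_ge0; exact: variance_ge0. Qed.

(** Lets the recursion, an almost sure identity, be used inside covariances. *)
Lemma rcov_ae_eq (X X' Y : {mfun T >-> R}) :
  {ae P, forall w, X w = X' w} -> rcov X Y = rcov X' Y.
Proof.
move=> XX'; rewrite /rcov !unlock; congr fine.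
have mE (f : T -> R) : measurable_fun setT f -> measurable_fun setT (EFin \o f).
  by move=> mf; exact: measurableT_comp.
have -> : (\int[P]_w (X w)%:E = \int[P]_w (X' w)%:E)%E.
  apply: ae_eq_integral => //; try by apply: mE; exact: measurable_funPT.
  by apply: filterS XX' => w -> _.
apply: ae_eq_integral => //.
- by apply: mE; apply: measurable_funM; exact: measurable_funB.
- by apply: mE; apply: measurable_funM; exact: measurable_funB.
by apply: filterS XX' => w wE _; rewrite -[LHS]/(((X w - _) * _)%:E) wE.
Qed.

(* Each step subtracts from [Z] its projection on one more noise variable. *)
Lemma bessel_inequality (I : eqType) (noise : I -> T -> R) (s2 : R) Y (s : seq I) :
  0 < s2 -> Y \in Lfun P 2%:E -> (forall k, noise k \in Lfun P 2%:E) ->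
  (forall k, rcov (noise k) (noise k) = s2) ->
  (forall k l, k != l -> rcov (noise k) (noise l) = 0) -> uniq s ->
  \sum_(k <- s) rcov Y (noise k) ^+ 2 <= s2 * rcov Y Y.
Proof.
move=> s20 Y2 n2 nvar ncov us.
suff [Z [Z2 _ ZZ]] : exists Z, [/\ Z \in Lfun P 2%:E,
    forall l, l \notin s -> rcov Z (noise l) = rcov Y (noise l) &
    s2 * rcov Z Z = s2 * rcov Y Y - \sum_(k <- s) rcov Y (noise k) ^+ 2].
  by rewrite -subr_ge0 -ZZ mulr_ge0 ?rcov_ge0 // ltW.
elim: s us => [_|k s IH /= /andP[ks /IH [Z [Z2 Zl ZZ]]]].
  by exists Y; split=> //; rewrite big_nil subr0.
set g := rcov Y (noise k); pose t := - (g / s2).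
have tn2 : t \o* noise k \in Lfun P 2%:E by exact: Lfun2_scale.
have Z'2 := Lfun2D Z2 tn2.
exists (Z \+ t \o* noise k); split=> //.
  move=> l; rewrite inE negb_or => /andP[lk ls].
  by rewrite rcovDl // rcovZl // ncov 1?eq_sym // mulr0 addr0 Zl.
rewrite big_cons rcovDl // rcovZl // (rcovC Z) (rcovC (noise k)) !rcovDl // !rcovZl //.
rewrite nvar (rcovC (noise k)) Zl // -/g mulrDr [s2 * (rcov Z Z + _)]mulrDr ZZ /t.
by field; rewrite gt_eqF.
Qed.

End real_covariance.

(** The covariance of the recursion with eps_0 gives the equation for g. Bessel's inequality
    concerns one fixed variable X_0 against all the noise, while g fixes eps_0 and moves X. Joint
    stationarity of X and eps is not assumed, but the recursion writes eps as a finite combination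
    of values of X, so cov(X_p, eps_q) depends on p - q only; this is [g_bessel]. *)
Lemma stationary_field_l2_solution {R : realType} d (T : measurableType d)
    (P : probability T R) (s2 a b c : R) (eps X : int -> int -> {RV P >-> R}) :
  0 < s2 -> uncorrelated_noise s2 eps -> wide_sense_stationary X ->
  satisfies_recursion a b c eps X -> has_l2_solution 1 (- a) (- b) (- c).
Proof.
move=> s20 [eps2 _ eps_var eps_cov] [X2 _ X_cov] rec.
have recr (Y : {RV P >-> R}) i j : (Y : T -> R) \in Lfun P 2%:E ->
    rcov P (X i j) Y = a * rcov P (X (i - 1) j) Y + b * rcov P (X i (j - 1)) Y
      + c * rcov P (X (i - 1) (j - 1)) Y + rcov P (eps i j) Y.
  move=> Y2.
  pose V : {mfun T >-> R} := a \o* X (i - 1) j \+ b \o* X i (j - 1)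
    \+ c \o* X (i - 1) (j - 1) \+ eps i j.
  have -> : rcov P (X i j) Y = rcov P V Y.
    by apply: rcov_ae_eq; apply: filterS (rec i j) => w -> /=; ring.
  have Z2 t k l : t \o* X k l \in Lfun P 2%:E by exact: Lfun2_scale.
  by rewrite !rcovDl ?rcovZl //; do ?apply: Lfun2D; rewrite ?Z2.
have X_shift i j k l : rcov P (X i j) (X k l) = rcov P (X 0 0) (X (k - i) (l - j)).
  have := X_cov (i - k) (j - l) i j 0 0.
  by rewrite /rcov !subKr !sub0r !opprB => ->.
have eps_rcovv i j : rcov P (eps i j) (eps i j) = s2.
  exact: (congr1 fine (eps_var i j)).
have eps_cov0 i j : rcov P (eps i j) (eps 0 0) = s2 * ((i == 0) && (j == 0))%:R.
  have [/andP[/eqP -> /eqP ->]|n0] := boolP ((i == 0) && (j == 0)).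
    by rewrite mulr1 eps_rcovv.
  by rewrite mulr0 /rcov eps_cov // => -[i0 j0]; rewrite i0 j0 in n0.
have eps_rcov (Y : {RV P >-> R}) i j : (Y : T -> R) \in Lfun P 2%:E ->
    rcov P Y (eps i j) = rcov P Y (X i j) - a * rcov P Y (X (i - 1) j)
      - b * rcov P Y (X i (j - 1)) - c * rcov P Y (X (i - 1) (j - 1)).
  move=> Y2; rewrite !(rcovC P Y).
  by rewrite (recr Y i j) //; ring.
pose g i j := rcov P (X i j) (eps 0 0).
have g_bessel i j : g i j = rcov P (X 0 0) (eps (- i) (- j)).
  rewrite /g !eps_rcov // !(X_shift i j) !sub0r.
  by congr (_ - _ * rcov P _ (X _ _) - _ * rcov P _ (X _ _) - _ * rcov P _ (X _ _)); ring.
exists (fun i j => g i j / s2); split.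
  move=> i j; rewrite -[RHS](mulKf (lt0r_neq0 s20)) -eps_cov0 /g (recr (eps 0 0) i j) //; field.
  by rewrite gt_eqF.
exists (s2 * rcov P (X 0 0) (X 0 0) / s2 ^+ 2) => n.
rewrite (intsum_box (fun i j => (g i j / s2) ^+ 2)).
pose neg (k : int * int) := (- k.1, - k.2).
have neg_inj : injective neg by move=> [x y] [x' y'] [/oppr_inj -> /oppr_inj ->].
pose noise (k : int * int) : T -> R := eps k.1 k.2.
have := @bessel_inequality R d T P _ noise s2 (X 0 0) [seq neg k | k <- box n] s20 (X2 0 0).
rewrite map_inj_uniq // box_uniq big_map => /(_ _ _ _ isT) bessel.
rewrite ler_pdivlMr ?exprn_gt0 // mulr_suml.
apply: le_trans (bessel _ _ _).
- by apply: ler_sum => k _; rewrite expr_div_n divfK ?expf_neq0 ?gt_eqF // g_bessel.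
- by move=> k; exact: eps2.
- by move=> k; exact: eps_rcovv.
- move=> k l kl; rewrite /rcov eps_cov // => kl'.
  by move: kl; rewrite (surjective_pairing k) kl' -surjective_pairing eqxx.
Qed.

Unset Implicit Arguments.

Theorem proposition1 (R : realType) (sigma a b c : R) (hsigma : 0 < sigma ^+ 2) :
  (exists (d : measure_display) (T : measurableType d) (P : probability T R)
          (eps X : int -> int -> {RV P >-> R}),
     [/\ uncorrelated_noise (sigma ^+ 2) eps,
         wide_sense_stationary X &
         satisfies_recursion a b c eps X])
  <->
  0 < (1 - a - b - c) * (1 - a + b + c) * (1 + a - b + c) * (1 + a + b - c).
Proof.
split=> [[d [T [P [eps [X [noise stat rec]]]]]]|D0].
  rewrite ltNge; apply/negP => /no_l2_solution; apply.
  exact: stationary_field_l2_solution noise stat rec.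
apply: stationary_field_exists; last exact: l2_solution_exists.
by move: hsigma; rewrite lt0r sqrf_eq0 => /andP[].
Qed.
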